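(* Let $C=(c_{0,0},c_{0,1},c_{1,1},c_{1,2},c_{1,3},c_{1,4},c_{2,3})\in\mathbb{C}^7$ and $C'=(c'_{0,0},c'_{0,1},c'_{1,1},c'_{1,2},c'_{1,3},c'_{1,4},c'_{2,3})\in\mathbb{C}^7$. The two filiform Leibniz algebras $L(C)$ and $L(C')$ from $TLeib_7$ are isomorphic if and only if there exist $A_0,A_1,B_1,B_2,B_3\in\mathbb{C}$ such that $A_0B_1\neq 0$ and the following equalities hold: \begin{align*} c'_{0,0}&=\frac{A_0^2c_{0,0}+A_0A_1c_{0,1}+A_1^2c_{1,1}}{A_0^5B_1},\\ c'_{0,1}&=\frac{2A_1c_{1,1}+A_0c_{0,1}}{A_0^5},\\ c'_{1,1}&=\frac{B_1c_{1,1}}{A_0^5},\\ c'_{1,2}&=\frac{B_1c_{1,2}}{A_0^2},\\ c'_{1,3}&=\frac{B_1\left(A_0c_{1,3}+2A_1c_{1,2}^2\right)}{A_0^4},\\ c'_{1,4}&=\frac{A_0^2B_1^2c_{1,4}+A_0^2(B_2^2-2B_1B_3)c_{2,3}+A_1B_1^2(5c_{1,2}-c_{2,3})(A_0c_{1,3}+A_1c_{1,2}^2)}{A_0^6B_1},\\ c'_{2,3}&=\frac{B_1c_{2,3}}{A_0^2}. \end{align*}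
   Context: All algebras are over $\mathbb{C}$. A Leibniz algebra is an algebra whose bilinear product satisfies $[x,[y,z]]=[[x,y],z]-[[x,z],y]$ for all $x,y,z$. For $C=(c_{0,0},c_{0,1},c_{1,1},c_{1,2},c_{1,3},c_{1,4},c_{2,3})\in\mathbb{C}^7$, $L(C)$ denotes the $7$-dimensional complex algebra with basis $e_0,e_1,\dots,e_6$ and products (products of basis vectors not listed are zero): $[e_i,e_0]=e_{i+1}$ for $1\le i\le 5$; $[e_0,e_i]=-e_{i+1}$ for $2\le i\le 5$; $[e_0,e_0]=c_{0,0}e_6$; $[e_0,e_1]=-e_2+c_{0,1}e_6$; $[e_1,e_1]=c_{1,1}e_6$; $[e_1,e_2]=-[e_2,e_1]=c_{1,2}e_4+c_{1,3}e_5+c_{1,4}e_6$; $[e_1,e_3]=-[e_3,e_1]=c_{1,2}e_5+c_{1,3}e_6$; $[e_1,e_4]=-[e_4,e_1]=(c_{1,2}-c_{2,3})e_6$; $[e_2,e_3]=-[e_3,e_2]=c_{2,3}e_6$. The class $TLeib_7$ is the set of all algebras $L(C)$, $C\in\mathbb{C}^7$. ''Isomorphic'' means isomorphic as algebras over $\mathbb{C}$. *)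

(* Defs.v *)
From HB Require Import structures.
From mathcomp Require Import all_boot all_order all_algebra.
From mathcomp Require Import reals.
From mathcomp Require Import complex.
From mathcomp Require Import ring.

Set Implicit Arguments.
Unset Strict Implicit.
Unset Printing Implicit Defensive.

Import Order.TTheory GRing.Theory Num.Theory.
Local Open Scope ring_scope.

Definition leibniz_identity (K : pzRingType) (V : lmodType K)
    (br : V -> V -> V) : Prop :=
  forall x y z, br x (br y z) = br (br x y) z - br (br x z) y.

Definition alg_isomorphic (K : pzRingType) (V W : lmodType K)
    (brV : V -> V -> V) (brW : W -> W -> W) : Prop :=
  exists f : {linear V -> W},
    bijective f /\ forall x y, f (brV x y) = brW (f x) (f y).

Record params (K : Type) := Params {
  c00 : K; c01 : K; c11 : K; c12 : K; c13 : K; c14 : K; c23 : K }.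

Section TLeib7.
Variable K : fieldType.
Implicit Type C : params K.

(* Meaningful for k < 7 only: inord sends larger k to 0. *)
Definition e (k : nat) : 'rV[K]_7 := delta_mx 0 (inord k).
Arguments e : simpl never.

(* The product [e_i, e_j] in L(C). *)
Definition basis_br C (i j : nat) : 'rV[K]_7 :=
  match (i, j) with
  | (0, 0)%N => c00 C *: e 6
  | (0, 1)%N => - e 2 + c01 C *: e 6
  | (0, 2)%N => - e 3
  | (0, 3)%N => - e 4
  | (0, 4)%N => - e 5
  | (0, 5)%N => - e 6
  | (1, 0)%N => e 2
  | (2, 0)%N => e 3
  | (3, 0)%N => e 4
  | (4, 0)%N => e 5
  | (5, 0)%N => e 6
  | (1, 1)%N => c11 C *: e 6
  | (1, 2)%N => c12 C *: e 4 + c13 C *: e 5 + c14 C *: e 6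
  | (2, 1)%N => - (c12 C *: e 4 + c13 C *: e 5 + c14 C *: e 6)
  | (1, 3)%N => c12 C *: e 5 + c13 C *: e 6
  | (3, 1)%N => - (c12 C *: e 5 + c13 C *: e 6)
  | (1, 4)%N => (c12 C - c23 C) *: e 6
  | (4, 1)%N => - ((c12 C - c23 C) *: e 6)
  | (2, 3)%N => c23 C *: e 6
  | (3, 2)%N => - (c23 C *: e 6)
  | _ => 0
  end.

(* L(C) is 'rV[K]_7 equipped with this product. *)
Definition br C (x y : 'rV[K]_7) : 'rV[K]_7 :=
  \sum_(i < 7) \sum_(j < 7) (x 0 i * y 0 j) *: basis_br C i j.

Lemma br_e C (i j : nat) : (i < 7)%N -> (j < 7)%N ->
  br C (e i) (e j) = basis_br C i j.
Proof.
move=> i7 j7; rewrite /br (bigD1 (inord i)) //= (bigD1 (inord j)) //=.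
rewrite !big1 ?addr0 => [|k ki|k kj].
- by rewrite !mxE !eqxx !mulr1 scale1r !inordK.
- by rewrite big1 // => k' _; rewrite !mxE (negPf ki) andbF mul0r scale0r.
- by rewrite !mxE (negPf kj) andbF mulr0 scale0r.
Qed.

Lemma br_coord C (x y : 'rV[K]_7) :
  let a k := x 0 (inord k) in let b k := y 0 (inord k) in
  br C x y = (a 1%N * b 0%N - a 0%N * b 1%N) *: e 2
    + (a 2%N * b 0%N - a 0%N * b 2%N) *: e 3
    + (a 3%N * b 0%N - a 0%N * b 3%N + c12 C * (a 1%N * b 2%N - a 2%N * b 1%N)) *: e 4
    + (a 4%N * b 0%N - a 0%N * b 4%N + c13 C * (a 1%N * b 2%N - a 2%N * b 1%N)
       + c12 C * (a 1%N * b 3%N - a 3%N * b 1%N)) *: e 5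
    + (a 5%N * b 0%N - a 0%N * b 5%N + c00 C * a 0%N * b 0%N + c01 C * a 0%N * b 1%N
       + c11 C * a 1%N * b 1%N + c14 C * (a 1%N * b 2%N - a 2%N * b 1%N)
       + c13 C * (a 1%N * b 3%N - a 3%N * b 1%N)
       + (c12 C - c23 C) * (a 1%N * b 4%N - a 4%N * b 1%N)
       + c23 C * (a 2%N * b 3%N - a 3%N * b 2%N)) *: e 6.
Proof.
move=> a b; rewrite /br.
have -> : forall F : nat -> nat -> 'rV[K]_7,
  \sum_(i < 7) \sum_(j < 7) (x 0 i * y 0 j) *: F i j =
  \sum_(0 <= i < 7) \sum_(0 <= j < 7) (a i * b j) *: F i j.
  move=> F; rewrite big_mkord; apply: eq_bigr => i _; rewrite big_mkord.
  by apply: eq_bigr => j _; rewrite /a /b !inord_val.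
rewrite unlock /= /basis_br !scaler0 !addr0 ?add0r.
move: (e 2) (e 3) (e 4) (e 5) (e 6) => e2 e3 e4 e5 e6.
move: (a 0%N) (a 1%N) (a 2%N) (a 3%N) (a 4%N) (a 5%N) => a0 a1 a2 a3 a4 a5.
move: (b 0%N) (b 1%N) (b 2%N) (b 3%N) (b 4%N) (b 5%N) => b0 b1 b2 b3 b4 b5.
by apply/rowP => k; rewrite !mxE; ring.
Qed.

Lemma e_inord (k l : nat) : (k < 7)%N -> (l < 7)%N ->
  e k 0 (inord l) = (l == k)%:R.
Proof. by move=> k7 l7; rewrite mxE eqxx /= -val_eqE /= !inordK. Qed.

Lemma br_coef C (x y : 'rV[K]_7) :
  let a k := x 0 (inord k) in let b k := y 0 (inord k) in
  let c k := br C x y 0 (inord k) in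
  (c 0%N = 0) * (c 1%N = 0) *
  (c 2%N = a 1%N * b 0%N - a 0%N * b 1%N) *
  (c 3%N = a 2%N * b 0%N - a 0%N * b 2%N) *
  (c 4%N = a 3%N * b 0%N - a 0%N * b 3%N
           + c12 C * (a 1%N * b 2%N - a 2%N * b 1%N)) *
  (c 5%N = a 4%N * b 0%N - a 0%N * b 4%N
           + c13 C * (a 1%N * b 2%N - a 2%N * b 1%N)
           + c12 C * (a 1%N * b 3%N - a 3%N * b 1%N)).
Proof.
have rD (u v : 'rV[K]_7) k : (u + v) 0 k = u 0 k + v 0 k by rewrite mxE.
have rZ t (u : 'rV[K]_7) k : (t *: u) 0 k = t * u 0 k by rewrite mxE.
move=> a b c; rewrite /c br_coord -/(a _) -/(b _).
by do !split; rewrite !rD !rZ !e_inord //= !(mulr0, mulr1, addr0, add0r).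
Qed.

Lemma br_leibniz C : leibniz_identity (br C).
Proof.
move=> x y z; rewrite (br_coord _ x) (br_coord _ (br C x y)).
rewrite (br_coord _ (br C x z)) !br_coef.
move: (x 0 (inord 0)) (x 0 (inord 1)) (x 0 (inord 2)) (x 0 (inord 3))
  (x 0 (inord 4)) => x0 x1 x2 x3 x4.
move: (y 0 (inord 0)) (y 0 (inord 1)) (y 0 (inord 2)) (y 0 (inord 3))
  (y 0 (inord 4)) => y0 y1 y2 y3 y4.
move: (z 0 (inord 0)) (z 0 (inord 1)) (z 0 (inord 2)) (z 0 (inord 3))
  (z 0 (inord 4)) => z0 z1 z2 z3 z4.
move: (e 2) (e 3) (e 4) (e 5) (e 6) => e2 e3 e4 e5 e6.
by apply/rowP => k; rewrite !mxE; ring.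
Qed.

End TLeib7.

(* Main.v *)
Require Import Defs.
From HB Require Import structures.
From mathcomp Require Import all_boot all_order all_algebra.
From mathcomp Require Import reals.
From mathcomp Require Import complex.
From mathcomp Require Import ring zify.

(** An isomorphism onto [L(C')] is the same thing as a basis of [L(C)] whose
    structure constants are those of [C'].  Such a basis [E] is generated by its
    first two vectors [x = E 0] and [y = E 1] through [E (k+1) = [E k, x]] for
    [k >= 1], so everything reduces to reading off the structure constants of
    [E] from the coordinates of [x] and [y].

    The key computation ([adapted_mx_br]) concerns any [x] and [y] with
    [y_0 = 0] and [x_0 y_1 <> 0]: the linear map sending [e_k] to [E k] is
    multiplicative from [L(transform C x_0 x_1 y_1 y_2 y_3)] to [L(C)], where
    [transform] collects the seven rational formulas.  Only five products, those
    of [E i] and [E j] for [(i,j)] among (0,0), (0,1), (1,1), (1,2) and (2,3),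
    are computed in coordinates.  The Leibniz identity deduces (1,3) and (1,4)
    from (1,2); the bracket is skew as soon as one argument lies in the span of
    [e_2, ..., e_6]; and the products left vanish because of a filtration.

    If the formulas hold, take [x = A0 e_0 + A1 e_1] and
    [y = B1 e_1 + B2 e_2 + B3 e_3]: the matrix of [E] is triangular with nonzero
    diagonal, and its inverse is an isomorphism ([isomorphic_transform]).
    Conversely, let [f] be an isomorphism, and [x], [y] the preimages of [e_0],
    [e_1].  Then [f] maps [E k] to [e_k].  Since [E 6 <> 0], both [x_0] and
    [x_0 y_1 - x_1 y_0] are nonzero; since [[E 1, E 2]] must lie in the span of
    [E 4, E 5, E 6] while its [e_3]-coordinate is a nonzero multiple of [y_0],
    also [y_0 = 0].  So the key computation applies: [L(C')] and
    [L(transform C ...)] have the same product, and the product determines the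
    parameters ([transform_isomorphic]).  The argument works over any field. *)

Import Order.TTheory GRing.Theory Num.Theory.
Local Open Scope ring_scope.
Local Open Scope complex_scope.

(** * Bilinearity and coordinates of the product *)

Section Filiform.
Variable K : fieldType.
Implicit Types (C : params K) (x y z : 'rV[K]_7).

Local Notation co x k := (x 0 (inord k)).

Lemma rV7P x y : (forall k, (k < 7)%N -> co x k = co y k) -> x = y.
Proof.
by move=> xy; apply/rowP => i; have := xy i (ltn_ord i); rewrite inord_val.
Qed.

Lemma coD x y k : co (x + y) k = co x k + co y k. Proof. by rewrite mxE. Qed.
Lemma coN x k : co (- x) k = - co x k. Proof. by rewrite mxE. Qed.
Lemma coZ t x k : co (t *: x) k = t * co x k. Proof. by rewrite mxE. Qed.
Lemma co0 k : co (0 : 'rV[K]_7) k = 0. Proof. by rewrite mxE. Qed.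
Definition coE := (coD, coN, coZ, co0).

Lemma sum_e x : x = \sum_(i < 7) x 0 i *: e K i.
Proof.
rewrite {1}[x]row_sum_delta; apply: eq_bigr => i _.
by rewrite /e inord_val.
Qed.

Lemma br_co6 C x y :
  co (br C x y) 6 = co x 5 * co y 0 - co x 0 * co y 5 + c00 C * co x 0 * co y 0
    + c01 C * co x 0 * co y 1 + c11 C * co x 1 * co y 1
    + c14 C * (co x 1 * co y 2 - co x 2 * co y 1)
    + c13 C * (co x 1 * co y 3 - co x 3 * co y 1)
    + (c12 C - c23 C) * (co x 1 * co y 4 - co x 4 * co y 1)
    + c23 C * (co x 2 * co y 3 - co x 3 * co y 2).
Proof. by rewrite br_coord !coE !e_inord //= !(mulr0, mulr1, addr0, add0r). Qed.

Definition br_coE C x y := (br_coef C x y, br_co6 C x y).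

Lemma br_is_linear C x : linear (br C x).
Proof.
move=> t y z; rewrite !(br_coord C x) /=.
by apply/rowP => k; rewrite !mxE; ring.
Qed.

HB.instance Definition _ C x :=
  GRing.isLinear.Build K 'rV[K]_7 'rV[K]_7 *:%R (br C x) (br_is_linear C x).

Lemma br_linearl C t x y z : br C (t *: x + y) z = t *: br C x z + br C y z.
Proof.
by rewrite !(br_coord C _ z) /=; apply/rowP => k; rewrite !mxE; ring.
Qed.

Lemma brDl C x y z : br C (x + y) z = br C x z + br C y z.
Proof. by have := br_linearl C 1 x y z; rewrite !scale1r. Qed.

Lemma br0l C y : br C 0 y = 0.
Proof.
by have := br_linearl C (-1) 0 0 y; rewrite scaler0 addr0 scaleN1r addNr.
Qed.

Lemma brZl C t x y : br C (t *: x) y = t *: br C x y.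
Proof. by have := br_linearl C t x 0 y; rewrite br0l !addr0. Qed.

Lemma br_sum C (a b : 'I_7 -> K) (u v : 'I_7 -> 'rV[K]_7) :
  br C (\sum_i a i *: u i) (\sum_j b j *: v j) =
  \sum_i \sum_j (a i * b j) *: br C (u i) (v j).
Proof.
rewrite (big_morph (br C ^~ _) (fun x y => brDl C x y _) (br0l C _)).
apply: eq_bigr => i _; rewrite brZl (linear_sum (br C (u i))) /= scaler_sumr.
by apply: eq_bigr => j _; rewrite linearZ /= scalerA.
Qed.

(** * Skew-symmetry and the natural filtration *)

(** The symmetric part [[u,v] + [v,u]] only involves the coordinates of [u] and
    [v] along [e_0] and [e_1]. *)
Lemma br_skew C x y : co y 0 = 0 -> co y 1 = 0 -> br C x y = - br C y x.
Proof.
move=> y0 y1; apply: rV7P; case=> [|[|[|[|[|[|[|k]]]]]]] // _;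
  by rewrite !coE !br_coE ?y0 ?y1; ring.
Qed.

(** Not a consequence of skew-symmetry in characteristic 2. *)
Lemma br_diag C x : co x 0 = 0 -> co x 1 = 0 -> br C x x = 0.
Proof.
move=> x0 x1; apply: rV7P; case=> [|[|[|[|[|[|[|k]]]]]]] // _;
  by rewrite !coE !br_coE ?x0 ?x1; ring.
Qed.

(** For [2 <= k <= 7] these subspaces are the terms of the lower central
    series. *)
Definition tail (k : nat) x := forall l, (l < k)%N -> co x l = 0.

(** For [i, j >= 1], the table of products shows that [[e_i, e_j]] lies in the
    span of the [e_k] with [k >= i + j + 1], and no [e_k] has [k >= 7]. *)
Lemma br_tail_eq0 C i j x y : (0 < i)%N -> (0 < j)%N -> (6 <= i + j)%N ->
  tail i x -> tail j y -> br C x y = 0.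
Proof.
move=> i0 j0 ij xi yj.
have xy0 k l : (k + l < 6)%N -> co x k * co y l = 0.
  move=> kl; have [/xi->|ik] := ltnP k i; first by rewrite mul0r.
  by rewrite yj ?mulr0 //; lia.
apply: rV7P; case=> [|[|[|[|[|[|[|k]]]]]]] // _;
  by rewrite !coE !br_coE -?mulrA ?xy0 //; ring.
Qed.

Lemma br_tail C k x y : (1 < k < 7)%N -> tail k x -> tail k.+1 (br C x y).
Proof.
move=> /andP[k1 k7] xk l lk.
have xl p : (p < l)%N -> co x p = 0 by move=> pl; apply: xk; lia.
case: l lk xl {xk} => [|[|[|[|[|[|[|l]]]]]]] lk xl; last by lia.
all: by rewrite !br_coE // !xl //; ring.
Qed.

(** On the quotients of the lower central series, right multiplication by [y]
    is [y_0] times the shift, as [[e_i, e_j]] with [j >= 1] gains more than one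
    step. *)
Lemma br_lead C k x y : (1 < k < 6)%N -> tail k x ->
  co (br C x y) k.+1 = co x k * co y 0.
Proof.
case: k => [|[|[|[|[|[|k]]]]]] // _ x0; rewrite !br_coE.
- by rewrite (x0 0) //; ring.
- by rewrite (x0 0) // (x0 1) // (x0 2) //; ring.
- by rewrite (x0 0) // (x0 1) // (x0 2) // (x0 3) //; ring.
- by rewrite (x0 0) // (x0 1) // (x0 2) // (x0 3) // (x0 4) //; ring.
Qed.

(** * The basis generated by two vectors *)

Fixpoint adapted C x y k : 'rV[K]_7 :=
  match k with
  | 0%N => x
  | 1%N => y
  | k'.+1 => br C (adapted C x y k') x
  end.

(** The structure constants of the basis [adapted C x y] for [x], [y] with
    coordinates [a_i], [b_i] and [b_0 = 0]. *)
Definition transform C (a0 a1 b1 b2 b3 : K) : params K := Params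
  ((a0 ^+ 2 * c00 C + a0 * a1 * c01 C + a1 ^+ 2 * c11 C) / (a0 ^+ 5 * b1))
  ((2 * a1 * c11 C + a0 * c01 C) / a0 ^+ 5)
  (b1 * c11 C / a0 ^+ 5)
  (b1 * c12 C / a0 ^+ 2)
  (b1 * (a0 * c13 C + 2 * a1 * c12 C ^+ 2) / a0 ^+ 4)
  ((a0 ^+ 2 * b1 ^+ 2 * c14 C + a0 ^+ 2 * (b2 ^+ 2 - 2 * b1 * b3) * c23 C
    + a1 * b1 ^+ 2 * (5 * c12 C - c23 C) * (a0 * c13 C + a1 * c12 C ^+ 2))
   / (a0 ^+ 6 * b1))
  (b1 * c23 C / a0 ^+ 2).

Section Basis.
Variables (C : params K) (x y : 'rV[K]_7).

Local Notation E := (adapted C x y).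
Local Notation a k := (co x k).
Local Notation b k := (co y k).

Lemma adaptedS k : (0 < k)%N -> E k.+1 = br C (E k) x.
Proof. by case: k. Qed.

Lemma adapted0 : E 0 = x. Proof. by []. Qed.
Lemma adapted1 : E 1 = y. Proof. by []. Qed.

Lemma adapted_low k : (1 < k)%N -> co (E k) 0 = 0 /\ co (E k) 1 = 0.
Proof. by case: k => [|[|k]] // _; rewrite !br_coE. Qed.

(* Simplification must leave the vectors [E k] folded. *)
Local Opaque adapted.

Lemma adapted_tail k : (1 < k < 8)%N -> tail k (E k).
Proof.
elim: k => [|[|[|k]] IHk] // k8.
  by have [E0 E1] := @adapted_low 2 isT; case=> [|[|l]].
by rewrite adaptedS //; apply: br_tail => //; apply: IHk; lia.
Qed.

Lemma adapted7 : E 7 = 0.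
Proof. by apply: rV7P => k k7; rewrite co0 adapted_tail. Qed.

Lemma adapted_co0 :
  (co (E 2) 0 = 0) * (co (E 2) 1 = 0) *
  (co (E 3) 0 = 0) * (co (E 3) 1 = 0) * (co (E 3) 2 = 0) *
  (co (E 4) 0 = 0) * (co (E 4) 1 = 0) * (co (E 4) 2 = 0) * (co (E 4) 3 = 0) *
  (co (E 5) 0 = 0) * (co (E 5) 1 = 0) * (co (E 5) 2 = 0) * (co (E 5) 3 = 0) *
  (co (E 5) 4 = 0) *
  (co (E 6) 0 = 0) * (co (E 6) 1 = 0) * (co (E 6) 2 = 0) * (co (E 6) 3 = 0) *
  (co (E 6) 4 = 0) * (co (E 6) 5 = 0).
Proof. by do !split; apply: adapted_tail. Qed.

Hypothesis y0 : b 0 = 0.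

(** This lemma and the next four give the coordinates that enter the structure
    constants.  Those of [E 2] along [e_5] and [e_6] do not, which keeps the
    expressions small. *)
Lemma adapted2_co :
  (co (E 2) 2 = a 0 * b 1) *
  (co (E 2) 3 = a 0 * b 2) *
  (co (E 2) 4 = a 0 * b 3 + c12 C * (b 1 * a 2 - b 2 * a 1)).
Proof. by rewrite adaptedS // adapted1 !br_coE y0; do !split; ring. Qed.

Lemma adapted3_co :
  (co (E 3) 3 = a 0 ^+ 2 * b 1) *
  (co (E 3) 4 = a 0 ^+ 2 * b 2 - c12 C * a 1 * (a 0 * b 1)) *
  (co (E 3) 5 = a 0 * co (E 2) 4 - c13 C * a 1 * co (E 2) 2
                - c12 C * a 1 * co (E 2) 3).
Proof.
rewrite (adaptedS 2) // !(br_coE C (E 2)).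
by rewrite !adapted_co0 !adapted2_co; do !split; ring.
Qed.

Lemma adapted4_co :
  (co (E 4) 4 = a 0 ^+ 3 * b 1) *
  (co (E 4) 5 = a 0 * co (E 3) 4 - c12 C * a 1 * co (E 3) 3) *
  (co (E 4) 6 = a 0 * co (E 3) 5 - c13 C * a 1 * co (E 3) 3
                - (c12 C - c23 C) * a 1 * co (E 3) 4
                - c23 C * a 2 * co (E 3) 3).
Proof.
rewrite (adaptedS 3) // !(br_coE C (E 3)).
by rewrite !adapted_co0 !adapted3_co; do !split; ring.
Qed.

Lemma adapted5_co :
  (co (E 5) 5 = a 0 ^+ 4 * b 1) *
  (co (E 5) 6 = a 0 * co (E 4) 5 - (c12 C - c23 C) * a 1 * co (E 4) 4).
Proof.
rewrite (adaptedS 4) // !(br_coE C (E 4)).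
by rewrite !adapted_co0 !adapted4_co; do !split; ring.
Qed.

Lemma adapted6_co : co (E 6) 6 = a 0 ^+ 5 * b 1.
Proof.
rewrite (adaptedS 5) // !(br_coE C (E 5)).
by rewrite !adapted_co0 !adapted5_co; ring.
Qed.

Hypothesis xy_neq0 : a 0 * b 1 != 0.

Let C'' := transform C (a 0) (a 1) (b 1) (b 2) (b 3).

Let x0_neq0 : a 0 != 0.
Proof. by apply: contraNneq xy_neq0 => ->; rewrite mul0r. Qed.
Let y1_neq0 : b 1 != 0.
Proof. by apply: contraNneq xy_neq0 => ->; rewrite mulr0. Qed.

(** * Structure constants of the generated basis *)

Lemma adapted_br00 : br C (E 0) (E 0) = c00 C'' *: E 6.
Proof.
apply: rV7P; case=> [|[|[|[|[|[|[|k]]]]]]] // _;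
  rewrite coZ ?adapted_co0 ?mulr0 //;
  rewrite ?adapted0 ?adapted1 !(br_coE C x, br_coE C y) ?adapted6_co /=;
  [ring..|].
by field; rewrite x0_neq0 y1_neq0.
Qed.

Lemma adapted_br01 : br C (E 0) (E 1) = - E 2 + c01 C'' *: E 6.
Proof.
apply: rV7P; case=> [|[|[|[|[|[|[|k]]]]]]] // _;
  rewrite coD coN coZ ?adapted_co0 ?mulr0 ?addr0 //;
  rewrite ?adapted6_co ?(adaptedS 1) // adapted0 adapted1;
  rewrite !(br_coE C x, br_coE C y) ?y0 /=; [ring..|].
by field; rewrite x0_neq0.
Qed.

Lemma adapted_br11 : br C (E 1) (E 1) = c11 C'' *: E 6.
Proof.
apply: rV7P; case=> [|[|[|[|[|[|[|k]]]]]]] // _;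
  rewrite coZ ?adapted_co0 ?mulr0 //;
  rewrite ?adapted0 ?adapted1 !(br_coE C x, br_coE C y) ?adapted6_co /= ?y0;
  [ring..|].
by field; rewrite x0_neq0.
Qed.

(** Since [E 4], [E 5], [E 6] are triangular, the coordinates along [e_4], [e_5]
    and [e_6] determine the three coefficients one after the other. *)
Lemma adapted_br12 :
  br C (E 1) (E 2) = c12 C'' *: E 4 + c13 C'' *: E 5 + c14 C'' *: E 6.
Proof.
apply: rV7P; case=> [|[|[|[|[|[|[|k]]]]]]] // _;
  rewrite !coD !coZ ?adapted_co0 ?mulr0 ?addr0;
  rewrite adapted1 !(br_coE C y (E 2)) ?adapted_co0 ?y0;
  rewrite ?(adapted6_co, adapted5_co, adapted4_co, adapted3_co, adapted2_co) /=;
  [ring..|field|field|field]; by rewrite ?x0_neq0 ?y1_neq0.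
Qed.

Lemma adapted_br23 : br C (E 2) (E 3) = c23 C'' *: E 6.
Proof.
apply: rV7P; case=> [|[|[|[|[|[|[|k]]]]]]] // _;
  rewrite coZ ?adapted_co0 ?mulr0 //;
  rewrite !(br_coE C (E 2) (E 3)) ?adapted_co0;
  rewrite ?(adapted6_co, adapted3_co, adapted2_co) /=; [ring..|].
by field; rewrite x0_neq0.
Qed.

Lemma adapted_brE0 j : (1 < j)%N -> br C (E 0) (E j) = - E j.+1.
Proof.
move=> j1; have [Ej0 Ej1] := adapted_low j j1.
by rewrite br_skew // adapted0 adaptedS //; lia.
Qed.

(** Write [E 3 = [E 2, x]] and apply the Leibniz identity: right multiplication
    by [x] shifts the expansion of [[E 1, E 2]], and the correction term is
    [[E 2, E 2] = 0]. *)
Lemma adapted_br13 : br C (E 1) (E 3) = c12 C'' *: E 5 + c13 C'' *: E 6.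
Proof.
rewrite (adaptedS 2) // br_leibniz adapted_br12 -(adaptedS 1) //.
rewrite br_diag ?adapted_co0 // subr0 !brDl !brZl -!adaptedS //.
by rewrite adapted7 scaler0 addr0.
Qed.

(** Same argument one step further; the correction term is now [[E 2, E 3]],
    hence the difference of parameters. *)
Lemma adapted_br14 : br C (E 1) (E 4) = (c12 C'' - c23 C'') *: E 6.
Proof.
rewrite (adaptedS 3) // br_leibniz adapted_br13 -(adaptedS 1) //.
rewrite adapted_br23 !brDl !brZl -!adaptedS //.
by rewrite adapted7 scaler0 addr0 scalerBl.
Qed.

Lemma adapted_br_tail i j : (0 < i < 7)%N -> (0 < j < 7)%N -> (6 <= i + j)%N ->
  br C (E i) (E j) = 0.
Proof.
have E_tail k : (0 < k < 7)%N -> tail k (E k).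
  case: k => [|[|k]] // k7; last by apply: adapted_tail; lia.
  by case=> // _; rewrite adapted1.
move=> i7 j7 ij; apply: (br_tail_eq0 _ i j) => //; try lia; exact: E_tail.
Qed.

Definition adapted_mx : 'M[K]_7 := \matrix_(i < 7) E i.
Local Notation M := adapted_mx.

Lemma mul_adapted_mx u : u *m M = \sum_(i < 7) u 0 i *: E i.
Proof. by rewrite mulmx_sum_row; apply: eq_bigr => i _; rewrite rowK. Qed.

Lemma e_adapted_mx k : (k < 7)%N -> e K k *m M = E k.
Proof. by move=> k7; rewrite /e -rowE rowK inordK. Qed.

Lemma adapted_basis_br i j : (i < 7)%N -> (j < 7)%N ->
  br C (E i) (E j) = basis_br C'' i j *m M.
Proof.
have skew k l : (1 < l)%N -> br C (E k) (E l) = - br C (E l) (E k).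
  by move=> /adapted_low[l0 l1]; apply: br_skew.
have eM := e_adapted_mx.
case: i => [|[|[|[|[|[|[|i]]]]]]] // _; case: j => [|[|[|[|[|[|[|j]]]]]]] // _;
  rewrite /basis_br ?mul0mx ?mulNmx ?mulmxDl -?scalemxAl ?mulNmx ?eM //;
  try by apply: adapted_br_tail.
- exact: adapted_br00.
- exact: adapted_br01.
- by rewrite adapted_brE0.
- by rewrite adapted_brE0.
- by rewrite adapted_brE0.
- by rewrite adapted_brE0.
- by rewrite adapted_brE0 // adapted7 oppr0.
- exact: adapted_br11.
- exact: adapted_br12.
- exact: adapted_br13.
- exact: adapted_br14.
- by rewrite -adapted_br12 (skew 1) // opprK.
- by apply: br_diag; rewrite adapted_co0.
- exact: adapted_br23.
- by rewrite -adapted_br13 (skew 1) // opprK.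
- by rewrite -adapted_br23 (skew 2) // opprK.
- by rewrite -adapted_br14 (skew 1) // opprK.
- by rewrite adapted0 -adaptedS // adapted7.
Qed.

(** By bilinearity, the table of products of the [E k] says that the change of
    basis matrix intertwines the two products. *)
Lemma adapted_mx_br u v : br C'' u v *m M = br C (u *m M) (v *m M).
Proof.
rewrite (mul_adapted_mx u) (mul_adapted_mx v) br_sum.
rewrite [br C'' u v]/br mulmx_suml; apply: eq_bigr => i _.
rewrite mulmx_suml; apply: eq_bigr => j _.
by rewrite -scalemxAl -adapted_basis_br.
Qed.

(** The matrix is upper triangular with diagonal
    [x_0, y_1, x_0 y_1, x_0^2 y_1, ..., x_0^5 y_1]. *)
Lemma adapted_mx_unit : M \in unitmx.
Proof.
rewrite unitmxE unitfE -det_tr det_trig.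
  apply/prodf_neq0 => i _; rewrite !mxE -{2}[ i ]inord_val.
  case: i => [[|[|[|[|[|[|[|i]]]]]]] // i7] /=;
    rewrite ?adapted0 ?adapted1 //;
    rewrite ?(adapted6_co, adapted5_co, adapted4_co, adapted3_co, adapted2_co);
    by rewrite ?mulf_neq0 ?expf_neq0.
apply/is_trig_mxP => i j ij; rewrite !mxE -[ i ]inord_val.
case: j ij => [[|[|j]] j7] //= ij.
  by rewrite adapted1; case: i ij => [[|i] i7].
by rewrite adapted_tail //; lia.
Qed.

End Basis.

(** * Isomorphisms and parameters *)

Lemma br_inj C C' : br C =2 br C' -> C = C'.
Proof.
move=> CC'.
have basisE i j : (i < 7)%N -> (j < 7)%N -> basis_br C i j = basis_br C' i j.
  by move=> i7 j7; rewrite -!br_e.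
have coef i j k : (i < 7)%N -> (j < 7)%N ->
    co (basis_br C i j) k = co (basis_br C' i j) k.
  by move=> i7 j7; rewrite basisE.
have := (coef 0 0 6 isT isT, coef 0 1 6 isT isT, coef 1 1 6 isT isT,
  coef 1 2 4 isT isT, coef 1 2 5 isT isT,
  coef 1 2 6 isT isT, coef 2 3 6 isT isT)%N.
rewrite /basis_br !coE !e_inord //= !(mulr0, mulr1, addr0, add0r, oppr0).
case: C C' {CC' basisE coef} => ? ? ? ? ? ? ? [? ? ? ? ? ? ?] /=.
by do 6!case; do 7!move=> ->.
Qed.

(** The change of basis matrix of [adapted C x y] maps the transformed algebra
    to [L(C)], so the isomorphism is its inverse. *)
Lemma isomorphic_transform C (a0 a1 b1 b2 b3 : K) : a0 * b1 != 0 ->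
  alg_isomorphic (br C) (br (transform C a0 a1 b1 b2 b3)).
Proof.
move=> ab.
pose x := a0 *: e K 0 + a1 *: e K 1.
pose y := b1 *: e K 1 + b2 *: e K 2 + b3 *: e K 3.
have xE k : (k < 7)%N -> co x k = a0 * (k == 0%N)%:R + a1 * (k == 1%N)%:R.
  by move=> k7; rewrite !coE !e_inord.
have yE k : (k < 7)%N ->
    co y k = b1 * (k == 1%N)%:R + b2 * (k == 2%N)%:R + b3 * (k == 3%N)%:R.
  by move=> k7; rewrite !coE !e_inord.
have y0 : co y 0 = 0 by rewrite yE //= !(mulr0, mulr1, addr0, add0r).
have x0 : co x 0 = a0 by rewrite xE //= !(mulr0, mulr1, addr0, add0r).
have x1 : co x 1 = a1 by rewrite xE //= !(mulr0, mulr1, addr0, add0r).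
have y1 : co y 1 = b1 by rewrite yE //= !(mulr0, mulr1, addr0, add0r).
have y2 : co y 2 = b2 by rewrite yE //= !(mulr0, mulr1, addr0, add0r).
have y3 : co y 3 = b3 by rewrite yE //= !(mulr0, mulr1, addr0, add0r).
have xy : co x 0 * co y 1 != 0 by rewrite x0 y1.
have Mu := adapted_mx_unit C x y y0 xy.
have := adapted_mx_br C x y y0 xy; rewrite x0 x1 y1 y2 y3 => Mbr.
exists (mulmxr (invmx (adapted_mx C x y))); split.
  by exists (mulmxr (adapted_mx C x y)) => u /=; rewrite ?mulmxK ?mulmxKV.
by move=> u v /=; rewrite -[RHS](mulmxK Mu) Mbr !mulmxKV.
Qed.

(** The basis generated by the preimages of [e_0] and [e_1] is sent by [f] to
    the standard one, so its structure constants are [C']. *)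
Lemma transform_isomorphic C C' : alg_isomorphic (br C) (br C') ->
  exists a0 a1 b1 b2 b3 : K, a0 * b1 != 0 /\ C' = transform C a0 a1 b1 b2 b3.
Proof.
case=> f [[g gK fK] fbr]; have f_inj := can_inj gK.
pose x := g (e K 0); pose y := g (e K 1); pose E := adapted C x y.
have fE k : (k < 7)%N -> f (E k) = e K k.
  elim: k => [|[|k] IHk] k7; rewrite /E ?adapted0 ?adapted1 ?fK //.
  rewrite adaptedS // fbr IHk; last by lia.
  rewrite fK br_e //; last by lia.
  by move: k k7 {IHk} => [|[|[|[|[|k]]]]].
have E_co0 := adapted_co0 C x y; rewrite -/E in E_co0.
(* [d] is the determinant of the map induced on the quotient by the span of
   [e_2, ..., e_6]. *)
pose d := co y 1 * co x 0 - co y 0 * co x 1.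
have E2_lead : co (E 2) 2 = d by rewrite /E adaptedS // adapted1 br_coE.
have E_lead k : (1 < k < 6)%N -> co (E k.+1) k.+1 = co (E k) k * co x 0.
  move=> k6; rewrite /E adaptedS; last by lia.
  by apply: br_lead => //; apply: adapted_tail; lia.
have dx_neq0 : d * co x 0 != 0.
  apply/eqP => dx0; have := fE 6 isT.
  have -> : E 6 = 0.
    apply: rV7P; case=> [|[|[|[|[|[|[|k]]]]]]] // _;
      rewrite co0 ?E_co0 //.
    rewrite (E_lead 5) // (E_lead 4) // (E_lead 3) // (E_lead 2) //.
    by rewrite E2_lead dx0 !mul0r.
  rewrite linear0 => /rowP/(_ (inord 6)).
  by rewrite e_inord // mxE => /eqP; rewrite eq_sym oner_eq0.
have /[!mulf_eq0]/[!negb_or]/andP[d_neq0 x0_neq0] := dx_neq0.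
(* [[E 1, E 2]] has coordinate [- y_0 d] along [e_3], whereas its image under
   [f] forces it into the span of [E 4, E 5, E 6]. *)
have y0 : co y 0 = 0.
  have : br C (E 1) (E 2) = c12 C' *: E 4 + c13 C' *: E 5 + c14 C' *: E 6.
    by apply: f_inj; rewrite fbr !linearD !linearZ /= !fE // br_e.
  move=> /rowP/(_ (inord 3)); rewrite !coD !coZ !E_co0 !mulr0 !addr0.
  rewrite (br_coE C (E 1) (E 2)) E_co0 mulr0 sub0r E2_lead /E adapted1.
  by move/eqP; rewrite oppr_eq0 mulf_eq0 (negPf d_neq0) orbF => /eqP.
have xy_neq0 : co x 0 * co y 1 != 0.
  by move: d_neq0; rewrite /d y0 mul0r subr0 mulrC.
exists (co x 0), (co x 1), (co y 1), (co y 2), (co y 3); split=> //.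
have fM u : f (u *m adapted_mx C x y) = u.
  rewrite mul_adapted_mx linear_sum [RHS]sum_e; apply: eq_bigr => i _.
  by rewrite linearZ /= fE.
apply: br_inj => u v.
by rewrite -[RHS]fM adapted_mx_br // fbr !fM.
Qed.

End Filiform.
Arguments transform {K}.

Theorem theorem2p1 (R : realType) (C C' : params R[i]) :
  alg_isomorphic (br C) (br C') <->
  exists A0 A1 B1 B2 B3 : R[i],
    A0 * B1 != 0 /\
    c00 C' = (A0 ^+ 2 * c00 C + A0 * A1 * c01 C + A1 ^+ 2 * c11 C)
               / (A0 ^+ 5 * B1) /\
    c01 C' = (2 * A1 * c11 C + A0 * c01 C) / A0 ^+ 5 /\
    c11 C' = B1 * c11 C / A0 ^+ 5 /\
    c12 C' = B1 * c12 C / A0 ^+ 2 /\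
    c13 C' = B1 * (A0 * c13 C + 2 * A1 * c12 C ^+ 2) / A0 ^+ 4 /\
    c14 C' = (A0 ^+ 2 * B1 ^+ 2 * c14 C
              + A0 ^+ 2 * (B2 ^+ 2 - 2 * B1 * B3) * c23 C
              + A1 * B1 ^+ 2 * (5 * c12 C - c23 C)
                * (A0 * c13 C + A1 * c12 C ^+ 2))
               / (A0 ^+ 6 * B1) /\
    c23 C' = B1 * c23 C / A0 ^+ 2.
Proof.
split=> [/transform_isomorphic|] [a0 [a1 [b1 [b2 [b3]]]]].
  by case=> ab ->; exists a0, a1, b1, b2, b3.
case=> ab CE; suff -> : C' = transform C a0 a1 b1 b2 b3.
  exact: isomorphic_transform.
by case: C' CE => ? ? ? ? ? ? ? /= [-> [-> [-> [-> [-> [-> ->]]]]]].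
Qed.
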